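(* Let $S$ be a complete semiring, $(\mathbf{C},\otimes,I)$ a small strict monoidal category, $\mathcal{F}$ a system of fields and $\mathbb{T}$ a system of $\mathbf{C}$-valued action exponentials. Let $M$ be a closed $n$-manifold and view $M\times[0,1]$ as a bordism from $M=M\times\{0\}$ to $M=M\times\{1\}$. The state sum $Z_{M\times[0,1]}$ of the cylinder is idempotent, that is, $$\langle Z_{M\times[0,1]},Z_{M\times[0,1]}\rangle=Z_{M\times[0,1]}\in Z(M\sqcup M).$$
   Context: A semiring $(S,+,\cdot,0,1)$ consists of a commutative monoid $(S,+,0)$ and a (not necessarily commutative) monoid $(S,\cdot,1)$ such that $\cdot$ distributes over $+$ from both sides and $0$ is absorbing. A complete monoid is a commutative monoid $(M,+,0)$ with a summation law assigning to every family $(m_i)_{i\in I}$, $I$ an arbitrary set, an element $\sum_{i\in I}m_i$ such that $\sum_{i\in\varnothing}m_i=0$, $\sum_{i\in\{1\}}m_i=m_1$, $\sum_{i\in\{1,2\}}m_i=m_1+m_2$, and $\sum_{j\in J}\big(\sum_{i\in I_j}m_i\big)=\sum_{i\in I}m_i$ for every partition $I=\bigcup_{j\in J}I_j$. A semiring is complete if $(S,+,0,\sum)$ is a complete monoid and $\sum_i ss_i=s\sum_i s_i$, $\sum_i s_is=(\sum_i s_i)s$. $Q=Q_S(\mathbf{C})$ is the complete monoid of functions $\operatorname{Mor}(\mathbf{C})\to S$ with pointwise addition and summation. The composition semiring is $Q^c=(Q,+,\cdot,0,1)$ with $(a\cdot b)(\gamma)=\sum_{\beta\circ\alpha=\gamma}b(\beta)a(\alpha)$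 and $1$ the characteristic function of the set of identity morphisms; it is a complete semiring. Fix an integer $n\ge 0$. Manifolds are topological and need not be orientable; $\varnothing$ is a manifold of every dimension; $\sqcup$ is the ordered disjoint union. A bordism from $M$ to $N$ is a triple $(W,M,N)$ (often abbreviated $W$) with $W$ a compact $(n+1)$-dimensional topological manifold, $\partial W=M\sqcup N$, where the closed $n$-manifolds $M,N$ are the incoming and outgoing boundary. $(W,M,N)\sqcup(W',M',N')=(W\sqcup W',M\sqcup M',N\sqcup N')$. If $W'$ is a bordism from $M$ to $N$ and $W''$ a bordism from $N$ to $P$, gluing along $N$ yields the bordism $W'\cup_N W''$ from $M$ to $P$. A homeomorphism of bordisms is a homeomorphism preserving incoming and outgoing boundaries. $(W_0,M_0,N_0)$ is a subbordism of $(W,M,N)$ if $W_0\subset W$ is a codimension $0$ submanifold, every connected component $C$ of $M_0$ satisfies $C\cap\partial W=\varnothing$ or $C\subset M$, and every connected component $C$ of $N_0$ satisfies $C\cap\partial W=\varnothing$ or $C\subset N$. A system $\mathcal{F}$ of fields assigns to each bordism $W$ a set $\mathcal{F}(W)$ and to each closed $n$-manifold $M$ a set $\mathcal{F}(M)$, with $\mathcal{F}(\varnothing)$ a one-element set, such that: (FRES) There are restriction maps $\mathcal{F}(W)\to\mathcal{F}(W_0)$ for subbordisms $W_0\subset W$, $\mathcal{F}(M)\to\mathcal{F}(M_0)$ for codimension $0$ submanifolds $M_0\subset M$, and $\mathcal{F}(W)\to\mathcal{F}(M)$ for closed codimension $1$ submanifolds $M\subset W$; they are written $f\mapsto f|_{(-)}$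 and commute with each other in the obvious way (restricting in stages equals restricting directly). (FHOMEO) A homeomorphism of bordisms $\phi:W\to W'$ induces a bijection $\phi^*:\mathcal{F}(W')\to\mathcal{F}(W)$ with $(\operatorname{id}_W)^*=\operatorname{id}$, $(\psi\circ\phi)^*=\phi^*\circ\psi^*$; similarly for homeomorphisms of closed $n$-manifolds; these maps commute with the restriction maps. (FDISJ) The products of restrictions $\mathcal{F}(W\sqcup W')\to\mathcal{F}(W)\times\mathcal{F}(W')$ and $\mathcal{F}(M\sqcup N)\to\mathcal{F}(M)\times\mathcal{F}(N)$ are bijections. (FGLUE) For $W=W'\cup_N W''$, the map $\mathcal{F}(W)\to\mathcal{F}(W')\times_{\mathcal{F}(N)}\mathcal{F}(W'')$ given by the restrictions to $W'$ and $W''$ is a bijection onto the pullback. A system $\mathbb{T}$ of $\mathbf{C}$-valued action exponentials consists of functions $\mathbb{T}_W:\mathcal{F}(W)\to\operatorname{Mor}(\mathbf{C})$ for all bordisms $W$ with $\mathbb{T}_\varnothing(p)=\operatorname{id}_I$ ($p$ the unique element of $\mathcal{F}(\varnothing)$) such that: (TDISJ) $\mathbb{T}_{W\sqcup W'}(f)=\mathbb{T}_W(f|_W)\otimes\mathbb{T}_{W'}(f|_{W'})$; (TGLUE) for $W=W'\cup_NW''$, $\mathbb{T}_W(f)=\mathbb{T}_{W''}(f|_{W''})\circ\mathbb{T}_{W'}(f|_{W'})$; (THOMEO) for a homeomorphism of bordisms $\phi:W\to W'$ and $f\in\mathcal{F}(W')$, $\mathbb{T}_W(\phi^*f)=\mathbb{T}_{W'}(f)$.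 For a closed $n$-manifold $M$, the state module $Z(M)$ is the set of functions $z:\mathcal{F}(M)\to Q$ with $z(\phi^*f)=z(f)$ for all $f$ and all homeomorphisms $\phi:M\to M$ isotopic to the identity; equivalently functions on the quotient $\overline{\mathcal{F}}(M)$ of $\mathcal{F}(M)$ by $f\sim\phi^*f$. $Z(M)\,\widehat{\otimes}\,Z(N)$ is the set of functions $\overline{\mathcal{F}}(M)\times\overline{\mathcal{F}}(N)\to Q$, also regarded as functions on $\mathcal{F}(M)\times\mathcal{F}(N)$, and identified with $Z(M\sqcup N)$ via $\mathcal{F}(M\sqcup N)\cong\mathcal{F}(M)\times\mathcal{F}(N)$. For a bordism $W$ and $F\in\mathcal{F}(W)$, $T_W(F)\in Q$ is the characteristic function of the morphism $\mathbb{T}_W(F)$ (value $1\in S$ at $\mathbb{T}_W(F)$, $0$ elsewhere). For $f\in\mathcal{F}(\partial W)$ let $\mathcal{F}(W,f)=\{F\in\mathcal{F}(W)\mid F|_{\partial W}=f\}$. The state sum $Z_W\in Z(\partial W)$ is $Z_W(f)=\sum_{F\in\mathcal{F}(W,f)}T_W(F)\in Q$. For $z\in Z(M)\,\widehat{\otimes}\,Z(N)$ and $z'\in Z(N)\,\widehat{\otimes}\,Z(P)$, the contraction $\langle z,z'\rangle\in Z(M)\,\widehat{\otimes}\,Z(P)$ is $\langle z,z'\rangle(f,h)=\sum_{g\in\mathcal{F}(N)}z(f,g)\cdot z'(g,h)$, with product in $Q^c$. *)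

(* Defs.v *)
From HB Require Import structures.
From mathcomp Require Import all_boot all_order all_algebra.
From mathcomp Require Import all_classical all_reals all_analysis.
Set Implicit Arguments.
Unset Strict Implicit.
Unset Printing Implicit Defensive.
Import Order.TTheory GRing.Theory Num.Theory.
Import numFieldNormedType.Exports.
Local Open Scope classical_set_scope.
Local Open Scope ring_scope.

(* Index sets are types.  The laws for the index sets [{1}] and [{1,2}] are
   stated for all types with exactly one, resp. exactly two, elements, and a
   partition [I = \bigcup_(j in J) I_j] is a family [P] of subsets such that
   every [i : I] lies in exactly one [P j]. *)
HB.mixin Record isCompleteNmodule M of GRing.Nmodule M := {
  csum : forall I : Type, (I -> M) -> M ;
  csum_empty : forall (I : Type) (m : I -> M), (I -> False) -> csum I m = 0 ;
  csum_single : forall (I : Type) (i0 : I) (m : I -> M),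
    (forall i, i = i0) -> csum I m = m i0 ;
  csum_double : forall (I : Type) (i1 i2 : I) (m : I -> M),
    i1 <> i2 -> (forall i, i = i1 \/ i = i2) -> csum I m = m i1 + m i2 ;
  csum_partition : forall (I J : Type) (P : J -> set I) (m : I -> M),
    (forall i, exists! j, P j i) ->
    csum J (fun j => csum {i : I | P j i} (fun i => m (sval i))) = csum I m
}.

#[short(type="completeNmodType")]
HB.structure Definition CompleteNmodule :=
  {M of isCompleteNmodule M & GRing.Nmodule M}.

Arguments csum {_} [I] m.

HB.mixin Record CompleteNmodule_isCompleteSemiRing S
    of CompleteNmodule S & GRing.PzSemiRing S := {
  csum_distrr : forall (I : Type) (s : S) (m : I -> S),
    csum (fun i => s * m i) = s * csum m ;
  csum_distrl : forall (I : Type) (s : S) (m : I -> S),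
    csum (fun i => m i * s) = csum m * s
}.

#[short(type="completeSemiRingType")]
HB.structure Definition CompleteSemiRing :=
  {S of CompleteNmodule_isCompleteSemiRing S & CompleteNmodule S
        & GRing.PzSemiRing S}.

Section fct_completeNmodType.
Variables (T : Type) (M : completeNmodType).

Let fsum (I : Type) (m : I -> T -> M) : T -> M :=
  fun t => csum (fun i => m i t).

Let fsum_empty (I : Type) (m : I -> T -> M) : (I -> False) -> fsum m = 0.
Proof. by move=> I0; apply/funext => t; exact: csum_empty. Qed.

Let fsum_single (I : Type) (i0 : I) (m : I -> T -> M) :
  (forall i, i = i0) -> fsum m = m i0.
Proof. by move=> Ii0; apply/funext => t; exact: csum_single. Qed.

Let fsum_double (I : Type) (i1 i2 : I) (m : I -> T -> M) :
  i1 <> i2 -> (forall i, i = i1 \/ i = i2) -> fsum m = m i1 + m i2.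
Proof.
by move=> i12 Ii; apply/funext => t; exact: csum_double.
Qed.

Let fsum_partition (I J : Type) (P : J -> set I) (m : I -> T -> M) :
  (forall i, exists! j, P j i) ->
  fsum (fun j => fsum (fun i : {i : I | P j i} => m (sval i))) = fsum m.
Proof.
move=> PIJ; apply/funext => t.
exact: csum_partition (fun i => m i t) PIJ.
Qed.

HB.instance Definition _ := @isCompleteNmodule.Build (T -> M)
  fsum fsum_empty fsum_single fsum_double fsum_partition.

End fct_completeNmodType.

(* [comp b a] is b o a; it is a total function, meaningful only when
   [dom b = cod a]. *)
Record strict_monoidal_category := StrictMonoidalCategory {
  Ob : Type ;
  Mor : Type ;
  dom : Mor -> Ob ;
  cod : Mor -> Ob ;
  idm : Ob -> Mor ;
  comp : Mor -> Mor -> Mor ;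
  dom_idm : forall x, dom (idm x) = x ;
  cod_idm : forall x, cod (idm x) = x ;
  dom_comp : forall b a, dom b = cod a -> dom (comp b a) = dom a ;
  cod_comp : forall b a, dom b = cod a -> cod (comp b a) = cod b ;
  comp_idl : forall a, comp (idm (cod a)) a = a ;
  comp_idr : forall a, comp a (idm (dom a)) = a ;
  compA : forall c b a, dom c = cod b -> dom b = cod a ->
    comp c (comp b a) = comp (comp c b) a ;
  unit_ob : Ob ;
  tens_ob : Ob -> Ob -> Ob ;
  tens : Mor -> Mor -> Mor ;
  dom_tens : forall a b, dom (tens a b) = tens_ob (dom a) (dom b) ;
  cod_tens : forall a b, cod (tens a b) = tens_ob (cod a) (cod b) ;
  tens_idm : forall x y, tens (idm x) (idm y) = idm (tens_ob x y) ;
  tens_comp : forall b b' a a', dom b = cod a -> dom b' = cod a' ->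
    tens (comp b a) (comp b' a') = comp (tens b b') (tens a a') ;
  tens_obA : forall x y z, tens_ob x (tens_ob y z) = tens_ob (tens_ob x y) z ;
  tens_ob1l : forall x, tens_ob unit_ob x = x ;
  tens_ob1r : forall x, tens_ob x unit_ob = x ;
  tensA : forall a b c, tens a (tens b c) = tens (tens a b) c ;
  tens1l : forall a, tens (idm unit_ob) a = a ;
  tens1r : forall a, tens a (idm unit_ob) = a
}.

Arguments dom {_} _.
Arguments cod {_} _.
Arguments idm {_} _.
Arguments comp {_} _ _.
Arguments tens_ob {_} _ _.
Arguments tens {_} _ _.

Section composition_semiring.
Variables (S : completeSemiRingType) (C : strict_monoidal_category).

Definition Qmod : completeNmodType := (Mor C -> S : Type).

Definition qmul (a b : Qmod) : Qmod := fun c =>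
  csum (fun ba : {ba : Mor C * Mor C |
                   dom ba.1 = cod ba.2 /\ comp ba.1 ba.2 = c} =>
    b (sval ba).1 * a (sval ba).2).

Definition qchar (m : Mor C) : Qmod := fun c => if `[< c = m >] then 1 else 0.

End composition_semiring.

Section sum_topology.
Variables X Y : topologicalType.

Let sum_nbhs (z : X + Y) : set_system (X + Y)%type :=
  match z with inl x => inl @ nbhs x | inr y => inr @ nbhs y end.

Let sum_nbhs_proper z : ProperFilter (sum_nbhs z).
Proof. by case: z => ?; exact: fmap_proper_filter. Qed.

Let sum_nbhs_singleton z A : sum_nbhs z A -> A z.
Proof. by case: z => ? /=; exact: nbhs_singleton. Qed.

Let sum_nbhs_nbhs z A : sum_nbhs z A -> sum_nbhs z (sum_nbhs^~ A).
Proof. by case: z => ? /= /nbhs_interior; apply: filterS. Qed.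

HB.instance Definition _ := hasNbhs.Build (X + Y)%type sum_nbhs.
HB.instance Definition _ := Nbhs_isNbhsTopological.Build (X + Y)%type
  sum_nbhs_proper sum_nbhs_singleton sum_nbhs_nbhs.

End sum_topology.

Definition is_embedding (X Y : topologicalType) (f : X -> Y) : Prop :=
  injective f /\
  forall U : set X, open U <-> exists2 V : set Y, open V & f @^-1` V = U.

Definition is_homeomorphism (X Y : topologicalType) (f : X -> Y) : Prop :=
  continuous f /\
  exists g : Y -> X, [/\ continuous g, cancel f g & cancel g f].

Record embedding (X Y : topologicalType) := Embedding {
  emb_fun :> X -> Y ;
  embP : is_embedding emb_fun
}.

Section embedding_lemmas.
Implicit Types X Y Z T : topologicalType.

Lemma is_embeddingP X Y (f : X -> Y) : injective f ->
  (forall (x : X) (A : set X),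
     nbhs x A <-> exists2 B, nbhs (f x) B & f @^-1` B `<=` A) ->
  is_embedding f.
Proof.
move=> f_inj fP; split=> // U; split=> [oU|[V oV <-]]; last first.
  rewrite openE => x Vfx; apply/fP; exists V => //.
  exact: open_nbhs_nbhs.
exists (\bigcup_(V in [set V : set Y | open V /\ f @^-1` V `<=` U]) V).
  by apply: bigcup_open => V [].
rewrite eqEsubset; split=> [x [V [_ VU] Vfx]|x Ux]; first exact: VU.
have /fP[B] : nbhs x U by exact: open_nbhs_nbhs.
rewrite nbhsE => -[V [oV Vfx] VB] BU.
by exists V => //; split=> // y Vy; apply: BU; exact: VB.
Qed.

Lemma embedding_nbhs X Y (f : X -> Y) (x : X) (A : set X) : is_embedding f ->
  nbhs x A <-> exists2 B, nbhs (f x) B & f @^-1` B `<=` A.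
Proof.
move=> [f_inj fP]; split.
  rewrite nbhsE => -[U [/fP[V oV VU] Ux] UA]; exists V; last by rewrite VU.
  by apply: open_nbhs_nbhs; split=> //; have : (f @^-1` V) x by rewrite VU.
move=> [B]; rewrite nbhsE => -[V [oV Vfx] VB] BA.
rewrite nbhsE; exists (f @^-1` V); first by split=> //; apply/fP; exists V.
by move=> y Vy; apply: BA; exact: VB.
Qed.

Lemma embedding_continuous X Y (f : X -> Y) : is_embedding f -> continuous f.
Proof.
by move=> fE x B Bfx; apply/(embedding_nbhs _ _ fE); exists B.
Qed.

Lemma is_embedding_comp X Y Z (g : Y -> Z) (f : X -> Y) :
  is_embedding g -> is_embedding f -> is_embedding (g \o f).
Proof.
move=> gE fE; apply: is_embeddingP.
  by move=> x y /(proj1 gE) /(proj1 fE).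
move=> x A; split=> [/(embedding_nbhs _ _ fE)[B /(embedding_nbhs _ _ gE)]|].
  move=> [D Dx DB] BA; exists D => // y Dy; exact/BA/DB.
move=> [B Bx BA]; apply/(embedding_nbhs _ _ fE); exists (g @^-1` B) => //.
by apply/(embedding_nbhs _ _ gE); exists B.
Qed.

Lemma is_embedding_inl X Y : is_embedding (@inl X Y).
Proof.
apply: is_embeddingP => [x y []//|x A]; split=> [Ax|[B Bx BA]].
  2: exact: (filterS BA Bx).
exists (inl @` A); last by move=> y [z Az [<-]].
by apply: filterS Ax => y Ay; exists y.
Qed.

Lemma is_embedding_inr X Y : is_embedding (@inr X Y).
Proof.
apply: is_embeddingP => [x y []//|x A]; split=> [Ax|[B Bx BA]].
  2: exact: (filterS BA Bx).
exists (inr @` A); last by move=> y [z Az [<-]].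
by apply: filterS Ax => y Ay; exists y.
Qed.

Lemma is_embedding_val X (A : set X) : is_embedding (val : A -> X).
Proof. by split=> [|U]; [exact: val_inj|]. Qed.

Lemma nbhs_inl X Y (x : X) (A : set (X + Y)) :
  nbhs (inl x : (X + Y)%type) A <-> nbhs x (inl @^-1` A).
Proof. by []. Qed.

Lemma nbhs_inr X Y (y : Y) (A : set (X + Y)) :
  nbhs (inr y : (X + Y)%type) A <-> nbhs y (inr @^-1` A).
Proof. by []. Qed.

Lemma open_inl X Y (A : set X) : open A -> open (inl @` A : set (X + Y)).
Proof.
rewrite !openE => oA _ [x Ax <-]; have nA : nbhs x A := oA _ Ax.
change (nbhs x (@inl X Y @^-1` (inl @` A))).
by apply: (filterS _ nA) => z; exists z.
Qed.

Lemma open_inr X Y (A : set Y) : open A -> open (inr @` A : set (X + Y)).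
Proof.
rewrite !openE => oA _ [x Ax <-]; have nA : nbhs x A := oA _ Ax.
change (nbhs x (@inr X Y @^-1` (inr @` A))).
by apply: (filterS _ nA) => z; exists z.
Qed.

Lemma sum_compact X Y : compact [set: X] -> compact [set: Y] ->
  compact [set: (X + Y)%type].
Proof.
move=> cX cY; have -> : [set: (X + Y)%type] = inl @` setT `|` inr @` setT.
  rewrite eqEsubset; split=> // -[x|y] _; [left; by exists x|right; by exists y].
apply: compactU; apply: continuous_compact => //;
  apply: continuous_subspaceT; apply: embedding_continuous.
- exact: is_embedding_inl.
- exact: is_embedding_inr.
Qed.

Lemma cluster_continuous X Y (f : X -> Y) (x y : X) : continuous f ->
  cluster (nbhs x) y -> cluster (nbhs (f x)) (f y).
Proof.
move=> fc xy A B Ax By.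
have [z [Az Bz]] := xy (f @^-1` A) (f @^-1` B) (fc x _ Ax) (fc y _ By).
by exists (f z).
Qed.

Lemma sum_hausdorff X Y : hausdorff_space X -> hausdorff_space Y ->
  hausdorff_space (X + Y)%type.
Proof.
move=> hX hY [x|x] [y|y] xy.
- congr inl; apply: hX => A B Ax By.
  have [||z [[a Aa <-] [b Bb [ba]]]] := xy (inl @` A) (inl @` B).
  + by apply: filterS Ax => z; exists z.
  + by apply: filterS By => z; exists z.
  + by exists a; split=> //; rewrite -ba.
- have [||z [[a _ <-] [b _]]//] := xy (inl @` setT) (inr @` setT).
  + by apply: (@filterS _ (nbhs x) _ setT); [move=> z; exists z|exact: filterT].
  + by apply: (@filterS _ (nbhs y) _ setT); [move=> z; exists z|exact: filterT].
- have [||z [[a _ <-] [b _]]//] := xy (inr @` setT) (inl @` setT).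
  + by apply: (@filterS _ (nbhs x) _ setT); [move=> z; exists z|exact: filterT].
  + by apply: (@filterS _ (nbhs y) _ setT); [move=> z; exists z|exact: filterT].
- congr inr; apply: hY => A B Ax By.
  have [||z [[a Aa <-] [b Bb [ba]]]] := xy (inr @` A) (inr @` B).
  + by apply: filterS Ax => z; exists z.
  + by apply: filterS By => z; exists z.
  + by exists a; split=> //; rewrite -ba.
Qed.

Lemma prod_hausdorff X Y : hausdorff_space X -> hausdorff_space Y ->
  hausdorff_space (X * Y)%type.
Proof.
have fst_c : continuous (fst : X * Y -> X).
  move=> p A pA; exists (A, setT) => [|q []//].
  by split=> //; exact: filterT.
have snd_c : continuous (snd : X * Y -> Y).
  move=> p A pA; exists (setT, A) => [|q []//].
  by split=> //; exact: filterT.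
move=> hX hY p q pq; rewrite (surjective_pairing p) (surjective_pairing q); congr pair.
- exact/hX/(cluster_continuous fst_c pq).
- exact/hY/(cluster_continuous snd_c pq).
Qed.

Lemma set_type_hausdorff X (A : set X) : hausdorff_space X -> hausdorff_space A.
Proof.
move=> hX x y xy; apply/val_inj/hX/(cluster_continuous _ xy).
exact/embedding_continuous/is_embedding_val.
Qed.

Lemma set_type_compact X (A : set X) : compact A -> compact [set: A].
Proof.
move=> cA F FF _.
have [|x [Ax xF]] := cA (val @ F).
  by apply: (@filterS _ F _ setT) => [x _|]; [exact/set_mem/(valP x)|exact: filterT].
exists (exist _ x (mem_set Ax)); split=> // B D FB.
move=> /(embedding_nbhs _ _ (is_embedding_val A))[E Ex ED].
have [|z [[y By <-] Ez]] := xF (val @` B) E _ Ex.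
  by apply: (@filterS _ F _ B) => // y By; exists y.
by exists y; split=> //; exact: ED.
Qed.

Lemma is_embedding_cancel X Y (f : X -> Y) (g : Y -> X) :
  continuous f -> continuous g -> cancel f g -> is_embedding f.
Proof.
move=> fc gc fK; apply: is_embeddingP; first exact: can_inj fK.
move=> x A; split=> [Ax|[B Bx BA]]; last exact: (filterS BA (fc x B Bx)).
exists (g @^-1` A); first by apply: gc; rewrite fK.
by move=> y; rewrite /preimage /= fK.
Qed.

Lemma is_embedding_compL X Y Z (g : Y -> Z) (f : X -> Y) :
  is_embedding g -> is_embedding (g \o f) -> is_embedding f.
Proof.
move=> gE gfE; apply: is_embeddingP.
  by move=> x y fxy; apply: (proj1 gfE); rewrite /= fxy.
move=> x A; split=> [/(embedding_nbhs _ _ gfE)[B Bx BA]|[B]].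
  exists (g @^-1` B) => //; exact: (embedding_continuous gE).
move=> /(embedding_nbhs _ _ gE)[D Dx DB] BA.
by apply/(embedding_nbhs _ _ gfE); exists D => // y Dy; exact/BA/DB.
Qed.

Lemma is_embedding_prod X Y Z T (f : X -> Y) (g : Z -> T) :
  is_embedding f -> is_embedding g ->
  is_embedding (fun p : X * Z => (f p.1, g p.2)).
Proof.
move=> fE gE; apply: is_embeddingP.
  by move=> [x z] [x' z'] [/(proj1 fE)-> /(proj1 gE)->].
move=> [x z] A; split=> [|].
  move=> [[P Q] /= [/(embedding_nbhs _ _ fE)[P' P'x P'P]]].
  move=> /(embedding_nbhs _ _ gE)[Q' Q'z Q'Q] PQA.
  exists (P' `*` Q'); first by exists (P', Q').
  by move=> [u v] /= [Pu Qv]; apply: PQA; split; [exact: P'P|exact: Q'Q].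
move=> [B [[P Q] /= [Px Qz] PQB] BA].
exists (f @^-1` P, g @^-1` Q) => /=.
  by split; [exact: (embedding_continuous fE)|exact: (embedding_continuous gE)].
by move=> [u v] /= [Pu Qv]; apply: BA; exact: PQB.
Qed.

Lemma open_setX X Y (A : set X) (B : set Y) :
  open A -> open B -> open (A `*` B : set (X * Y)).
Proof.
move=> oA oB; rewrite openE => -[x y] [/= Ax By].
by exists (A, B) => //; split; exact: open_nbhs_nbhs.
Qed.

Lemma is_embedding_setX X Y (A : set X) (B : set Y) :
  is_embedding (@setX_of_sigT X Y A B).
Proof.
apply: (is_embedding_cancel (g := @sigT_of_setX X Y A B)).
- exact: setX_of_sigT_continuous.
- exact: sigT_of_setX_continuous.
- exact: setX_of_sigTK.
Qed.

Lemma compact_hausdorff_embedding X Y (f : X -> Y) : compact [set: X] ->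
  hausdorff_space Y -> continuous f -> injective f -> is_embedding f.
Proof.
move=> cX hY fc f_inj; split=> // U; split=> [oU|[V oV <-]]; last first.
  by move/continuousP : fc; apply.
exists (~` (f @` (~` U))).
  apply: closed_openC; apply: (compact_closed hY); apply: continuous_compact.
    exact: continuous_subspaceT.
  by apply: (subclosed_compact _ cX) => //; exact: open_closedC.
rewrite eqEsubset; split=> [x|x Ux [y nUy /f_inj xy]]; last by rewrite xy in nUy.
by move=> nfx; apply: contrapT => nUx; apply: nfx; exists x.
Qed.

Lemma sum_continuous X Y Z (f : X + Y -> Z) :
  continuous (f \o inl) -> continuous (f \o inr) -> continuous f.
Proof. by move=> fl fr [x|y]; [exact: fl|exact: fr]. Qed.

Lemma range_comp_surj (A B D : Type) (f : B -> D) (k : A -> B) :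
  (forall b, exists a, k a = b) -> range (f \o k) = range f.
Proof.
move=> kS; rewrite eqEsubset; split=> [_ [a _ <-]|_ [b _ <-]]; first by exists (k a).
by have [a <-] := kS b; exists a.
Qed.

Lemma chart_transport X Z (i : X -> Z) (U : set X) : is_embedding i ->
  exists k : (i @` U) -> U,
    [/\ is_embedding k, (forall u, exists z, k z = u) & forall z, i (val (k z)) = val z].
Proof.
move=> iE.
have kP (z : i @` U) : exists u : U, i (val u) = val z.
  have [x Ux ixz] := set_mem (valP z).
  by exists (exist _ x (mem_set Ux)).
pose k z := sval (cid (kP z)).
have kE z : i (val (k z)) = val z by rewrite /k; case: cid.
have jE : is_embedding (i \o (val : U -> X)).
  by apply: is_embedding_comp => //; exact: is_embedding_val.
exists k; split=> //.
  apply: (is_embedding_compL jE); rewrite (_ : _ \o _ = val).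
    exact: is_embedding_val.
  by apply/funext => z /=; exact: kE.
move=> u.
have iu : (i @` U) (i (val u)) by exists (val u) => //; exact/set_mem/(valP u).
exists (exist _ (i (val u)) (mem_set iu)).
by apply: (proj1 jE) => /=; rewrite kE.
Qed.

End embedding_lemmas.

Section manifolds.
Variables (R : realType) (n : nat).

Definition locally_euclidean (X : topologicalType) : Prop :=
  forall x : X, exists (U : set X) (f : U -> 'rV[R]_n),
    [/\ open U, U x, is_embedding f & open (range f)].

(* R^{n+1} is taken to be R^n x R. *)
Definition half_space : set ('rV[R]_n * R)%type := [set p | 0 <= p.2].

(* (X, B) is locally homeomorphic to (half_space, {p | p.2 = 0}), i.e. X is an
   (n+1)-dimensional manifold with boundary B.  By invariance of domain B is
   determined by X. *)
Definition manifold_with_boundary (X : topologicalType) (B : set X) : Prop :=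
  forall x : X, exists (U : set X) (f : U -> ('rV[R]_n * R)%type),
    [/\ open U, U x, is_embedding f,
        exists2 O, open O & range f = O `&` half_space
      & forall y : U, B (val y) <-> (f y).2 = 0].

(* Second countability is automatic for compact locally Euclidean spaces. *)
Record closed_manifold := ClosedManifold {
  cm_space :> topologicalType ;
  cm_compact : compact [set: cm_space] ;
  cm_hausdorff : hausdorff_space cm_space ;
  cm_euclidean : locally_euclidean cm_space
}.

Lemma sum_locally_euclidean (X Y : topologicalType) :
  locally_euclidean X -> locally_euclidean Y -> locally_euclidean (X + Y)%type.
Proof.
move=> lX lY [x|y].
- have [U [f [oU Ux fE of_]]] := lX x.
  have [k [kE kT kP]] := chart_transport U (is_embedding_inl X Y).
  exists (inl @` U), (f \o k); split; [exact: open_inl|by exists x| |].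
  + exact: is_embedding_comp.
  + by rewrite (range_comp_surj _ kT).
- have [U [f [oU Uy fE of_]]] := lY y.
  have [k [kE kT kP]] := chart_transport U (is_embedding_inr X Y).
  exists (inr @` U), (f \o k); split; [exact: open_inr|by exists y| |].
  + exact: is_embedding_comp.
  + by rewrite (range_comp_surj _ kT).
Qed.

Lemma sum_manifold_with_boundary (X Y : topologicalType) (B : set (X + Y)) :
  manifold_with_boundary (inl @^-1` B : set X) ->
  manifold_with_boundary (inr @^-1` B : set Y) ->
  @manifold_with_boundary (X + Y)%type B.
Proof.
move=> lX lY [x|y].
- have [U [f [oU Ux fE fO fB]]] := lX x.
  have [k [kE kT kP]] := chart_transport U (is_embedding_inl X Y).
  exists (inl @` U), (f \o k); split; [exact: open_inl|by exists x| | |].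
  + exact: is_embedding_comp.
  + by rewrite (range_comp_surj _ kT).
  + by move=> z; rewrite -kP; exact: fB.
- have [U [f [oU Uy fE fO fB]]] := lY y.
  have [k [kE kT kP]] := chart_transport U (is_embedding_inr X Y).
  exists (inr @` U), (f \o k); split; [exact: open_inr|by exists y| | |].
  + exact: is_embedding_comp.
  + by rewrite (range_comp_surj _ kT).
  + by move=> z; rewrite -kP; exact: fB.
Qed.

Definition closed_sum (M N : closed_manifold) : closed_manifold :=
  @ClosedManifold (M + N)%type
    (sum_compact (@cm_compact M) (@cm_compact N))
    (sum_hausdorff (@cm_hausdorff M) (@cm_hausdorff N))
    (sum_locally_euclidean (@cm_euclidean M) (@cm_euclidean N)).

Local Notation "M ⊔ N" := (closed_sum M N) (at level 50, left associativity).

Definition closed_inl (M N : closed_manifold) : embedding M (M ⊔ N) :=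
  Embedding (is_embedding_inl M N).

Definition closed_inr (M N : closed_manifold) : embedding N (M ⊔ N) :=
  Embedding (is_embedding_inr M N).

(* The equality "dW = M u N" is an identification of the ordered disjoint
   union of M and N with the boundary. *)
Record bordism (M N : closed_manifold) := Bordism {
  bd_space :> topologicalType ;
  bd : embedding (M ⊔ N) bd_space ;
  bd_compact : compact [set: bd_space] ;
  bd_hausdorff : hausdorff_space bd_space ;
  bd_manifold : manifold_with_boundary (range bd)
}.

Definition bd_in (M N : closed_manifold) (W : bordism M N) : embedding M W :=
  Embedding (is_embedding_comp (embP (bd W)) (is_embedding_inl M N)).

Definition bd_out (M N : closed_manifold) (W : bordism M N) : embedding N W :=
  Embedding (is_embedding_comp (embP (bd W)) (is_embedding_inr M N)).

Section bordism_sum.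
Variables (M N M' N' : closed_manifold) (W : bordism M N) (W' : bordism M' N').

Let sum_bd_fun (x : (M ⊔ M') ⊔ (N ⊔ N')) : (W + W')%type :=
  match x with
  | inl (inl m) => inl (bd_in W m)
  | inl (inr m') => inr (bd_in W' m')
  | inr (inl k) => inl (bd_out W k)
  | inr (inr k') => inr (bd_out W' k')
  end.

Let sum_bd_embedding : is_embedding sum_bd_fun.
Proof.
have ci := embedding_continuous (is_embedding_inl W W').
have cj := embedding_continuous (is_embedding_inr W W').
apply: compact_hausdorff_embedding.
- exact: cm_compact.
- by apply: sum_hausdorff; exact: bd_hausdorff.
- apply: sum_continuous; apply: sum_continuous => x.
  + exact: (continuous_comp (embedding_continuous (embP (bd_in W)) (x := x)) (ci _)).
  + exact: (continuous_comp (embedding_continuous (embP (bd_in W')) (x := x)) (cj _)).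
  + exact: (continuous_comp (embedding_continuous (embP (bd_out W)) (x := x)) (ci _)).
  + exact: (continuous_comp (embedding_continuous (embP (bd_out W')) (x := x)) (cj _)).
- by move=> [[x|x]|[x|x]] [[y|y]|[y|y]] //= [] /(proj1 (embP _)) e; congruence.
Qed.

Let sum_bd_manifold :
  @manifold_with_boundary (W + W')%type (range sum_bd_fun).
Proof.
apply: sum_manifold_with_boundary.
- rewrite (_ : _ @^-1` _ = range (bd W)); first exact: bd_manifold.
  rewrite eqEsubset; split=> w /=.
    by move=> [[[x|x]|[x|x]] _ //= [<-]]; [exists (inl x)|exists (inr x)].
  by move=> [[x|x] _ <-]; [exists (inl (inl x))|exists (inr (inl x))].
- rewrite (_ : _ @^-1` _ = range (bd W')); first exact: bd_manifold.
  rewrite eqEsubset; split=> w /=.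
    by move=> [[[x|x]|[x|x]] _ //= [<-]]; [exists (inl x)|exists (inr x)].
  by move=> [[x|x] _ <-]; [exists (inl (inr x))|exists (inr (inr x))].
Qed.

Definition bordism_sum : bordism (M ⊔ M') (N ⊔ N') :=
  @Bordism (M ⊔ M') (N ⊔ N') (W + W')%type (Embedding sum_bd_embedding)
    (sum_compact (@bd_compact _ _ W) (@bd_compact _ _ W'))
    (sum_hausdorff (@bd_hausdorff _ _ W) (@bd_hausdorff _ _ W'))
    sum_bd_manifold.

End bordism_sum.
Section cylinder.
Variable M : closed_manifold.

Definition unit_interval : topologicalType := (`[0, 1]%classic : set R).

Lemma I0_subproof : (0 : R) \in (`[0, 1]%classic : set R).
Proof. by rewrite inE /= in_itv /= lexx ler01. Qed.

Lemma I1_subproof : (1 : R) \in (`[0, 1]%classic : set R).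
Proof. by rewrite inE /= in_itv /= lexx ler01. Qed.

Definition I0 : unit_interval := exist _ 0 I0_subproof.
Definition I1 : unit_interval := exist _ 1 I1_subproof.

Let unit_intervalP (t : unit_interval) : 0 <= (val t : R) <= 1.
Proof. by have /set_mem /= := valP t; rewrite in_itv. Qed.

Let cyl_bd_fun (x : M ⊔ M) : (M * unit_interval)%type :=
  match x with inl m => (m, I0) | inr m => (m, I1) end.

Let cyl_compact : compact [set: (M * unit_interval)%type].
Proof.
rewrite -setXTT; apply: compact_setX; first exact: cm_compact.
exact/set_type_compact/segment_compact.
Qed.

Let cyl_hausdorff : hausdorff_space (M * unit_interval)%type.
Proof.
apply: prod_hausdorff; first exact: cm_hausdorff.
exact/set_type_hausdorff/Rhausdorff.
Qed.

Let pair_continuous (t : unit_interval) :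
  continuous (fun m : M => (m, t) : (M * unit_interval)%type).
Proof.
move=> m A [[P Q] /= [Pm Qt] PQA].
apply: (filterS _ Pm) => u Pu; apply: PQA; split=> //=.
exact: nbhs_singleton Qt.
Qed.

Let cyl_bd_embedding : is_embedding cyl_bd_fun.
Proof.
apply: compact_hausdorff_embedding => //; first exact: cm_compact.
- by apply: sum_continuous; exact: pair_continuous.
- have I01 : I0 = I1 -> False.
    by move=> /(congr1 val) /= /eqP; rewrite eq_sym oner_eq0.
  move=> [x|x] [y|y] /= e; have := congr1 fst e; have := congr1 snd e => /=.
  + by move=> _ ->.
  + by move/I01.
  + by move/esym/I01.
  + by move=> _ ->.
Qed.

(* The two half-open charts t and 1 - t of the interval. *)
Let half_chart (J : set unit_interval) (h : R -> R) (x : M) (t : unit_interval) :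
  open J -> J t -> is_embedding h ->
  range (fun s : J => h (val (val s))) = `[0, 1[%classic ->
  (forall s, J s -> forall m : M, range cyl_bd_fun (m, s) <-> h (val s) = 0) ->
  exists (U : set (M * unit_interval)) (f : U -> ('rV[R]_n * R)%type),
    [/\ open U, U (x, t), is_embedding f,
        exists2 O, open O & range f = O `&` half_space
      & forall y : U, range cyl_bd_fun (val y) <-> (f y).2 = 0].
Proof.
move=> oJ Jt hE hJ hB; have [U [f [oU Ux fE of_]]] := cm_euclidean x.
pose g (s : J) : R := h (val (val s)).
have gE : is_embedding g.
  apply: (is_embedding_comp hE); apply: is_embedding_comp;
    exact: is_embedding_val.
exists (U `*` J), ((fun p => (f p.1, g p.2)) \o @setX_of_sigT _ _ U J).
split.
- exact: open_setX.
- by [].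
- apply: is_embedding_comp; last exact: is_embedding_setX.
  exact: is_embedding_prod.
- exists (range f `*` [set r | r < 1]).
    by apply: open_setX => //; exact: open_lt.
  have gJ (s : J) : 0 <= g s < 1.
    have : range g (g s) by exists s.
    by rewrite hJ /= in_itv.
  rewrite eqEsubset; split=> [_ [p _ <-]|[v r] [[[u _ /= <-] r1] r0]].
    have /andP[g0 g1] := gJ (@setX_of_sigT M unit_interval U J p).2.
    by split=> //; split=> //; exists (@setX_of_sigT M unit_interval U J p).1.
  have : range g r by rewrite hJ /= in_itv /=; apply/andP.
  move=> [s _ <-]; exists (@sigT_of_setX M unit_interval U J (u, s)) => //.
  exact: (congr1 (fun p : U * J => (f p.1, g p.2)) (@sigT_of_setXK M unit_interval U J (u, s))).
- move=> [[m s] ms] /=; have [_ Js] := set_mem ms.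
  exact: hB.
Qed.

Let cyl_manifold : @manifold_with_boundary (M * unit_interval)%type (range cyl_bd_fun).
Proof.
move=> [x t].
have bdP (m : M) (s : unit_interval) :
    range cyl_bd_fun (m, s) <-> (val s : R) = 0 \/ (val s : R) = 1.
  split=> [[[y|y] _ [_ <-]]|[s0|s1]]; [by left|by right| |].
  - by exists (inl m) => //=; congr pair; apply/val_inj.
  - by exists (inr m) => //=; congr pair; apply/val_inj.
have valc (V : set R) : open V -> open ((val : unit_interval -> R) @^-1` V).
  have [_ valP] := is_embedding_val (`[0, 1]%classic : set R).
  by move=> oV; apply/valP; exists V.
have [t1|t1] := ltP (val t : R) 1.
- apply: (half_chart (J := val @^-1` [set r : R | r < 1]) (h := id)) => //.
  + exact: (valc _ (@open_lt R 1)).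
  + by apply: (is_embedding_cancel (g := id)) => // r; exact: cvg_id.
  + rewrite eqEsubset; split=> [_ [[s Js] _ <-]|r] /=.
      have /= := set_mem Js; have /andP[s0 _] := unit_intervalP s.
      by rewrite in_itv /= s0.
    rewrite in_itv /= => /andP[r0 r1].
    have rI : r \in (`[0, 1]%classic : set R).
      by rewrite inE /= in_itv /= r0 ltW.
    by exists (exist _ (exist _ r rI : unit_interval) (mem_set r1)).
  + move=> s s1 m; split=> [/bdP[//|s1']|s0]; last by apply/bdP; left.
    by move: s1; rewrite /= s1' ltxx.
- have opp_cont : continuous (fun r : R => 1 - r).
    by move=> r; apply: cvgB; [exact: cvg_cst|exact: cvg_id].
  apply: (half_chart (J := val @^-1` [set r : R | 0 < r]) (h := fun r => 1 - r)).
  + exact: (valc _ (@open_gt R 0)).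
  + by rewrite /= (lt_le_trans ltr01).
  + by apply: (is_embedding_cancel opp_cont opp_cont) => r; rewrite subKr.
  + rewrite eqEsubset; split=> [_ [[s Js] _ <-]|r] /=.
      have /= := set_mem Js; have /andP[_ s1] := unit_intervalP s.
      by rewrite in_itv /= subr_ge0 s1 ltrBlDr ltrDl.
    rewrite in_itv /= => /andP[r0 r1].
    have rI : 1 - r \in (`[0, 1]%classic : set R).
      by rewrite inE /= in_itv /= subr_ge0 ltW //= lerBlDr lerDl.
    have rJ : 0 < 1 - r by rewrite subr_gt0.
    exists (exist _ (exist _ (1 - r) rI : unit_interval) (mem_set rJ)) => //=.
    by rewrite subKr.
  + move=> s s0 m; split=> [/bdP[s0'|->]|/eqP].
    * by move: s0; rewrite /= s0' ltxx.
    * by rewrite subrr.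
    * by rewrite subr_eq0 => /eqP s1; apply/bdP; right.
Qed.

Definition cylinder : bordism M M :=
  @Bordism M M (M * unit_interval)%type (Embedding cyl_bd_embedding)
    cyl_compact cyl_hausdorff cyl_manifold.

End cylinder.

Record subbordism (M0 N0 M N : closed_manifold)
    (W0 : bordism M0 N0) (W : bordism M N) := Subbordism {
  sub_emb :> embedding W0 W ;
  sub_in : forall m : M0,
    let C := (sub_emb \o bd_in W0) @` connected_component setT m in
    C `&` range (bd W) = set0 \/ C `<=` range (bd_in W) ;
  sub_out : forall m : N0,
    let C := (sub_emb \o bd_out W0) @` connected_component setT m in
    C `&` range (bd W) = set0 \/ C `<=` range (bd_out W)
}.

Definition bordism_homeomorphism (M0 N0 M N : closed_manifold)
    (W0 : bordism M0 N0) (W : bordism M N) (phi : subbordism W0 W) : Prop :=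
  [/\ is_homeomorphism phi,
      phi @` range (bd_in W0) = range (bd_in W)
    & phi @` range (bd_out W0) = range (bd_out W)].

(* W = W' u_N W'': W is the union of the images of W' and W'', which meet
   exactly along N.  As all spaces are compact Hausdorff, W then carries the
   quotient topology of the pushout, so that W is the pushout up to a
   homeomorphism that is compatible with the boundary identifications. *)
Record is_gluing (M N P : closed_manifold)
    (W' : bordism M N) (W'' : bordism N P) (W : bordism M P)
    (i' : subbordism W' W) (i'' : subbordism W'' W) : Prop := {
  glue_cover : range i' `|` range i'' = setT ;
  glue_meet : forall x y,
    i' x = i'' y <-> exists k : N, x = bd_out W' k /\ y = bd_in W'' k ;
  glue_in : forall m, i' (bd_in W' m) = bd_in W m ;
  glue_out : forall p, i'' (bd_out W'' p) = bd_out W p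
}.

Section bordism_sum_inclusions.
Variables (M N M' N' : closed_manifold) (W : bordism M N) (W' : bordism M' N').

Program Definition bordism_inl : subbordism W (bordism_sum W W') :=
  @Subbordism _ _ _ _ _ _ (Embedding (is_embedding_inl W W')) _ _.
Next Obligation. by right=> _ [x _ <-]; exists (inl x). Qed.
Next Obligation. by right=> _ [x _ <-]; exists (inl x). Qed.

Program Definition bordism_inr : subbordism W' (bordism_sum W W') :=
  @Subbordism _ _ _ _ _ _ (Embedding (is_embedding_inr W W')) _ _.
Next Obligation. by right=> _ [x _ <-]; exists (inr x). Qed.
Next Obligation. by right=> _ [x _ <-]; exists (inr x). Qed.

End bordism_sum_inclusions.

Definition isotopic_to_id (M : closed_manifold) (phi : M -> M) : Prop :=
  exists H : M * unit_interval -> M,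
    [/\ continuous H,
        forall t, is_homeomorphism (fun x => H (x, t)),
        forall x, H (x, I0) = x
      & forall x, H (x, I1) = phi x].

End manifolds.

(* A submanifold is given by an embedding onto it.  Restriction along an
   embedding i : X -> Y is restriction to i(X) followed by pullback along the
   homeomorphism X -> i(X).  Thus [resM], [resW] and [resWM] comprise both the
   restriction maps and the pullbacks phi^*: the latter are the restrictions
   along homeomorphisms, bijective by functoriality, and functoriality also
   expresses that restrictions and pullbacks commute with each other. *)
Record field_system (R : realType) (n : nat) := FieldSystem {
  FM : closed_manifold R n -> Type ;
  FW : forall M N : closed_manifold R n, bordism M N -> Type ;
  resM : forall M0 M : closed_manifold R n, embedding M0 M -> FM M -> FM M0 ;
  resW : forall (M0 N0 M N : closed_manifold R n)
    (W0 : bordism M0 N0) (W : bordism M N),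
    subbordism W0 W -> FW W -> FW W0 ;
  resWM : forall (K M N : closed_manifold R n) (W : bordism M N),
    embedding K W -> FW W -> FM K ;
  FM_empty : forall M : closed_manifold R n,
    (M -> False) -> exists p : FM M, forall q, q = p ;
  FW_empty : forall (M N : closed_manifold R n) (W : bordism M N),
    (W -> False) -> exists p : FW W, forall q, q = p ;
  resM_id : forall (M : closed_manifold R n) (i : embedding M M) (f : FM M),
    i =1 id -> resM i f = f ;
  resM_comp : forall (M0 M1 M2 : closed_manifold R n)
    (i : embedding M0 M1) (j : embedding M1 M2) (k : embedding M0 M2) (f : FM M2),
    k =1 j \o i -> resM k f = resM i (resM j f) ;
  resW_id : forall (M N : closed_manifold R n) (W : bordism M N)
    (i : subbordism W W) (f : FW W), i =1 id -> resW i f = f ;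
  resW_comp : forall (M0 N0 M1 N1 M2 N2 : closed_manifold R n)
    (W0 : bordism M0 N0) (W1 : bordism M1 N1) (W2 : bordism M2 N2)
    (i : subbordism W0 W1) (j : subbordism W1 W2) (k : subbordism W0 W2)
    (f : FW W2), k =1 j \o i -> resW k f = resW i (resW j f) ;
  resWM_resW : forall (K M0 N0 M N : closed_manifold R n)
    (W0 : bordism M0 N0) (W : bordism M N)
    (i : embedding K W0) (j : subbordism W0 W) (k : embedding K W) (f : FW W),
    k =1 j \o i -> resWM k f = resWM i (resW j f) ;
  resWM_resM : forall (K0 K M N : closed_manifold R n) (W : bordism M N)
    (i : embedding K0 K) (j : embedding K W) (k : embedding K0 W) (f : FW W),
    k =1 j \o i -> resWM k f = resM i (resWM j f) ;
  FM_disj : forall M N : closed_manifold R n,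
    bijective (fun f : FM (closed_sum M N) =>
      (resM (closed_inl M N) f, resM (closed_inr M N) f)) ;
  FW_disj : forall (M N M' N' : closed_manifold R n)
    (W : bordism M N) (W' : bordism M' N'),
    bijective (fun f : FW (bordism_sum W W') =>
      (resW (bordism_inl W W') f, resW (bordism_inr W W') f)) ;
  FW_glue : forall (M N P : closed_manifold R n)
    (W' : bordism M N) (W'' : bordism N P) (W : bordism M P)
    (i' : subbordism W' W) (i'' : subbordism W'' W),
    is_gluing i' i'' ->
    forall (f' : FW W') (f'' : FW W''),
      resWM (bd_out W') f' = resWM (bd_in W'') f'' ->
      exists! f : FW W, resW i' f = f' /\ resW i'' f = f''
}.

Record action_exponentials (R : realType) (n : nat)
    (C : strict_monoidal_category) (F : field_system R n) := ActionExponentials {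
  TW : forall (M N : closed_manifold R n) (W : bordism M N), FW F W -> Mor C ;
  TW_empty : forall (M N : closed_manifold R n) (W : bordism M N) (p : FW F W),
    (W -> False) -> TW p = idm (unit_ob C) ;
  TW_disj : forall (M N M' N' : closed_manifold R n)
    (W : bordism M N) (W' : bordism M' N') (f : FW F (bordism_sum W W')),
    TW f = tens (TW (resW (bordism_inl W W') f))
                (TW (resW (bordism_inr W W') f)) ;
  TW_glue : forall (M N P : closed_manifold R n)
    (W' : bordism M N) (W'' : bordism N P) (W : bordism M P)
    (i' : subbordism W' W) (i'' : subbordism W'' W),
    is_gluing i' i'' ->
    forall f : FW F W,
      dom (TW (resW i'' f)) = cod (TW (resW i' f)) /\
      TW f = comp (TW (resW i'' f)) (TW (resW i' f)) ;
  TW_homeo : forall (M N M' N' : closed_manifold R n)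
    (W : bordism M N) (W' : bordism M' N') (phi : subbordism W W'),
    bordism_homeomorphism phi ->
    forall f : FW F W', TW (resW phi f) = TW f
}.

Section state_sums.
Variables (R : realType) (n : nat) (S : completeSemiRingType).
Variables (C : strict_monoidal_category) (F : field_system R n).
Variable (T : action_exponentials C F).
Implicit Types M N P : closed_manifold R n.

Definition state_module M : set (FM F M -> Qmod S C) :=
  [set z | forall phi : embedding M M, isotopic_to_id phi ->
           forall f, z (resM phi f) = z f].

Definition state_sum M N (W : bordism M N) : FM F (closed_sum M N) -> Qmod S C :=
  fun f => csum (fun G : {G : FW F W | resWM (bd W) G = f} =>
                   qchar S (TW T (sval G))).

(* The identification of functions on F(M u N) with functions on F(M) x F(N). *)
Lemma field_pairP M N (f : FM F M) (g : FM F N) :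
  exists h : FM F (closed_sum M N),
    resM (closed_inl M N) h = f /\ resM (closed_inr M N) h = g.
Proof.
have [h _ hK] := FM_disj F M N.
by exists (h (f, g)); have := hK (f, g) => -[].
Qed.

Definition field_pair M N (f : FM F M) (g : FM F N) : FM F (closed_sum M N) :=
  sval (cid (field_pairP f g)).

Definition to_pairs M N (z : FM F (closed_sum M N) -> Qmod S C) :
  FM F M -> FM F N -> Qmod S C := fun f g => z (field_pair f g).

Definition of_pairs M N (z : FM F M -> FM F N -> Qmod S C) :
  FM F (closed_sum M N) -> Qmod S C :=
  fun h => z (resM (closed_inl M N) h) (resM (closed_inr M N) h).

Definition state_contraction M N P (z : FM F M -> FM F N -> Qmod S C)
    (z' : FM F N -> FM F P -> Qmod S C) : FM F M -> FM F P -> Qmod S C :=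
  fun f h => csum (fun g : FM F N => qmul (z f g) (z' g h)).

End state_sums.

(* Main.v *)
Require Import Defs.
From mathcomp Require Import all_boot all_order all_algebra.
From mathcomp Require Import all_classical all_reals all_analysis.
From mathcomp Require Import lra.
Set Implicit Arguments.
Unset Strict Implicit.
Unset Printing Implicit Defensive.
Import Order.TTheory GRing.Theory Num.Theory.
Import numFieldNormedType.Exports.
Local Open Scope classical_set_scope.
Local Open Scope ring_scope.

(** The sum over the field on the middle copy of [M], together with the two sums
    over the fields on the two cylinders that extend it, ranges over the pairs
    of fields that agree on the middle copy.  By the gluing axiom these pairs
    are the fields on the glued bordism, and the product in the composition
    semiring of the two characteristic functions is the characteristic function
    of the composite, that is, of the action exponential of the glued field.
    Hence [<Z_W', Z_W''> = Z_W] whenever [W] is glued from [W'] and [W'']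
    ([state_sum_glue]); the semiring part is that [qmul] distributes over
    arbitrary sums ([qmul_csum]).  The cylinder is glued from two copies of
    itself, embedded as the parts over [[0, 1/2]] and [[1/2, 1]]
    ([cylinder_gluing]), which gives idempotence.

    That the state sum lies in the state module means that it is invariant under
    homeomorphisms [phi] of [M u M] isotopic to the identity.  By connectedness
    of the interval the isotopy consists of isotopies [a] and [b] of the two
    summands, and [(x, t) |-> (b (a (x, 1 - t), t), t)] is a homeomorphism of
    the cylinder that restricts to [phi] on the boundary ([cylinder_isotopy]).
    Pulling back along it permutes the fields summed over and preserves their
    action exponentials ([state_sum_homeo]). *)

(** * Sums in complete monoids *)

Section complete_monoid.
Variable M : completeNmodType.

Lemma eq_csum (I : Type) (m m' : I -> M) : m =1 m' -> csum m = csum m'.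
Proof. by move=> /funext->. Qed.

(** A family of zeros is the family of sums over the blocks of the partition of
    the empty set into empty blocks. *)
Lemma csum0 (I : Type) : csum (fun _ : I => 0 : M) = 0.
Proof.
have e0 (A : Type) (m : A -> M) : (A -> False) -> csum m = 0.
  exact: csum_empty.
rewrite -[RHS](e0 False (fun _ => 0)) //.
rewrite -(csum_partition False I (fun _ => setT)) //.
by apply: eq_csum => i; rewrite e0 // => -[].
Qed.

(** Bijectivity of [h] is stated by unique preimages: then the fibres of [h] form
    a partition into one-element blocks. *)
Lemma csum_reindex (I J : Type) (h : I -> J) (m : J -> M) :
  (forall j, exists! i, h i = j) -> csum (fun i => m (h i)) = csum m.
Proof.
move=> hb; rewrite -(csum_partition I J (fun j i => h i = j)); last first.
  by move=> i; exists (h i); split.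
apply: eq_csum => j; have [i [hij i_uniq]] := hb j.
rewrite (csum_single _ (exist _ i hij)) /= ?hij //.
by move=> [i' hi']; apply: eq_exist; rewrite -(i_uniq _ hi').
Qed.

Lemma csum_pair (I J : Type) (m : I -> J -> M) :
  csum (fun p : I * J => m p.1 p.2) = csum (fun i => csum (m i)).
Proof.
rewrite -(csum_partition _ I (fun i (p : I * J) => p.1 = i)); last first.
  by move=> p; exists p.1; split.
apply: eq_csum => i.
rewrite -(csum_reindex (h := fun j => exist (fun p : I * J => p.1 = i) (i, j) erefl)) //.
move=> [[i' j] /= e]; subst i'; exists j; split=> // j' /(congr1 sval) /=.
by case.
Qed.

Lemma csum_exchange (I J : Type) (m : I -> J -> M) :
  csum (fun i => csum (m i)) = csum (fun j => csum (m^~ j)).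
Proof.
rewrite -!csum_pair.
rewrite -(csum_reindex (h := fun p : J * I => (p.2, p.1))) //.
by move=> [i j]; exists (j, i); split=> // -[j' i'] [-> ->].
Qed.

Lemma csum_delta (I : Type) (i0 : I) (m : I -> M) :
  (forall i, i <> i0 -> m i = 0) -> csum m = m i0.
Proof.
move=> m0; rewrite -(csum_partition I bool (fun b i => if b then i = i0 else i <> i0));
  last first.
  move=> i; have [->|ii0] := pselect (i = i0).
    by exists true; split=> // -[].
  by exists false; split=> // -[].
rewrite (csum_double _ true false) //; last by case; auto.
rewrite (csum_single _ (exist (fun i => i = i0) i0 erefl)) /=; last first.
  by move=> [i ii0]; apply: eq_exist.
rewrite [X in _ + X](_ : _ = 0) ?addr0 // -(csum0 {i | i <> i0}).
by apply: eq_csum => -[i ii0] /=; exact: m0.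
Qed.

End complete_monoid.

(** * The composition semiring *)

Section composition.
Variables (S : completeSemiRingType) (C : strict_monoidal_category).

Lemma csumMM (I J : Type) (a : I -> S) (b : J -> S) :
  csum b * csum a = csum (fun p : I * J => b p.2 * a p.1).
Proof.
rewrite (csum_pair (fun i j => b j * a i)) -csum_distrr.
by apply: eq_csum => i; rewrite csum_distrl.
Qed.

(** At each morphism the product of two sums is a sum, over the factorizations of
    the morphism, of products in [S]; these distribute over the sums, and the sum
    over factorizations is exchanged with the others. *)
Lemma qmul_csum (I J : Type) (a : I -> Qmod S C) (b : J -> Qmod S C) :
  qmul (csum a) (csum b) = csum (fun p : I * J => qmul (a p.1) (b p.2)).
Proof.
apply/funext => c; rewrite /qmul.
transitivity (csum (fun ba : {ba : Mor C * Mor C |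
    dom ba.1 = cod ba.2 /\ Defs.comp ba.1 ba.2 = c} =>
    csum (fun p : I * J => b p.2 (sval ba).1 * a p.1 (sval ba).2))).
  apply: eq_csum => ba.
  exact: (csumMM (fun i => a i (sval ba).2) (fun j => b j (sval ba).1)).
exact: csum_exchange.
Qed.

(** Among the factorizations of [comp b a] only the pair [(b, a)] contributes. *)
Lemma qmul_qchar (b a : Mor C) : dom b = cod a ->
  qmul (qchar S a) (qchar S b) = qchar S (Defs.comp b a).
Proof.
move=> ba; apply/funext => c; rewrite /qmul.
have [cE|cN] := pselect (c = Defs.comp b a).
  subst c; rewrite (csum_delta (i0 := exist _ (b, a) (conj ba erefl))).
    by rewrite /qchar !asboolT // mulr1.
  move=> [[b' a'] /= ba'] ne; rewrite /qchar.
  have [eb|nb] := pselect (b' = b); last by rewrite asboolF // mul0r.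
  have [ea|na] := pselect (a' = a); last by rewrite [in X in _ * X]asboolF // mulr0.
  by case: ne; subst; apply: eq_exist.
rewrite {3}/qchar asboolF // -[RHS](csum0 S {ba : Mor C * Mor C |
    dom ba.1 = cod ba.2 /\ Defs.comp ba.1 ba.2 = c}).
apply: eq_csum => -[[b' a'] /= [_ e]]; rewrite /qchar.
have [eb|nb] := pselect (b' = b); last by rewrite asboolF // mul0r.
have [ea|na] := pselect (a' = a); last by rewrite [in X in _ * X]asboolF // mulr0.
by case: cN; subst.
Qed.

End composition.

(** * Embeddings and homeomorphisms *)

Section topology.
Implicit Types X Y Z : topologicalType.

Lemma continuous_compose X Y Z (f : X -> Y) (g : Y -> Z) :
  continuous f -> continuous g -> continuous (g \o f).
Proof. by move=> fc gc x; apply: continuous_comp; [exact: fc|exact: gc]. Qed.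

Lemma continuous_pair X Y Z (f : X -> Y) (g : X -> Z) :
  continuous f -> continuous g -> continuous (fun x => (f x, g x)).
Proof. by move=> fc gc x; apply: cvg_pair; [exact: fc|exact: gc]. Qed.

Lemma continuous_fst X Y : continuous (fst : X * Y -> X).
Proof. by move=> p; exact: cvg_fst. Qed.

Lemma continuous_snd X Y : continuous (snd : X * Y -> Y).
Proof. by move=> p; exact: cvg_snd. Qed.

Lemma continuous_embedded X Y Z (f : X -> Y) (g : Y -> Z) :
  is_embedding g -> continuous (g \o f) -> continuous f.
Proof.
move=> gE gfc x A /(embedding_nbhs _ _ gE)[B Bgfx BA].
have gfB : nbhs x ((g \o f) @^-1` B) := gfc x B Bgfx.
by apply: (filterS _ gfB) => y; exact: BA.
Qed.

Lemma homeomorphism_inverse X Y (f : X -> Y) : is_homeomorphism f ->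
  exists g : embedding Y X, cancel f g /\ cancel g f.
Proof.
move=> [fc [g [gc fK gK]]].
by exists (Embedding (is_embedding_cancel gc fc gK)).
Qed.

Lemma surjective_embedding_homeomorphism X Y (f : X -> Y) :
  is_embedding f -> (forall y, exists x, f x = y) -> is_homeomorphism f.
Proof.
move=> fE /choice[g gK]; split; first exact: embedding_continuous.
exists g; split=> //; last by move=> x; apply: (proj1 fE); rewrite gK.
apply: (continuous_embedded fE _); rewrite (_ : f \o g = id).
  by move=> y; exact: cvg_id.
by apply/funext => y; exact: gK.
Qed.

Lemma clopen_range_inl X Y : clopen (range inl : set (X + Y)).
Proof.
split; first by apply: open_inl; exact: openT.
rewrite (_ : range inl = ~` range inr).
  by apply: open_closedC; apply: open_inr; exact: openT.
rewrite eqEsubset; split=> [_ [x _ <-] [y _]//|[x _|y]]; first by exists x.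
by case; exists y.
Qed.

Lemma clopen_range_inr X Y : clopen (range inr : set (X + Y)).
Proof.
split; first by apply: open_inr; exact: openT.
rewrite (_ : range inr = ~` range inl).
  by apply: open_closedC; apply: open_inl; exact: openT.
rewrite eqEsubset; split=> [_ [x _ <-] [y _]//|[y|x _]]; last by exists x.
by case; exists y.
Qed.

End topology.

(** * The unit interval and isotopies *)

Section interval.
Variable R : realType.
Local Notation I := (unit_interval R).

Lemma clip_subproof (r : R) : Num.max 0 (Num.min 1 r) \in (`[0, 1]%classic : set R).
Proof.
by rewrite inE /= in_itv /= le_max lexx /= ge_max ler01 /= ge_min lexx.
Qed.

(** Through this retraction of the line onto the interval, maps into the interval
    inherit continuity from real functions, and the interval inherits
    connectedness from the line. *)
Definition clip (r : R) : I :=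
  exist (fun x => x \in (`[0, 1]%classic : set R)) _ (clip_subproof r).

Lemma clipE (r : R) : 0 <= r <= 1 -> val (clip r) = r.
Proof. by move=> /andP[r0 r1] /=; rewrite min_r // max_r. Qed.

Lemma val_interval (t : I) : 0 <= (val t : R) <= 1.
Proof. by have /set_mem /= := valP t; rewrite in_itv. Qed.

Lemma continuous_clip : continuous clip.
Proof.
apply: (continuous_embedded (is_embedding_val _) _) => r /=.
apply: (@continuous_max R R (fun _ => 0) (fun r => Num.min 1 r)).
  exact: cvg_cst.
apply: (@continuous_min R R (fun _ => 1) id); [exact: cvg_cst|exact: cvg_id].
Qed.

Lemma continuous_val : continuous (val : I -> R).
Proof. exact/embedding_continuous/is_embedding_val. Qed.

Lemma interval_clopen (X : topologicalType) (A : set X) (c : I -> X) :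
  clopen A -> continuous c -> A (c (I0 R)) -> forall t, A (c t).
Proof.
move=> cA cc A0 t.
have clipK (s : I) : clip (val s) = s by apply/val_inj/clipE/val_interval.
have [oB cB] : clopen ((c \o clip) @^-1` A).
  by apply: preimage_clopen => //; exact: continuous_compose continuous_clip cc.
have B_all : (c \o clip) @^-1` A = [set: R].
  have /connected_intervalP : is_interval [set: R] by [].
  apply.
  - by exists (val (I0 R)); rewrite /preimage mksetE compE clipK.
  - by exists ((c \o clip) @^-1` A); last by rewrite setTI.
  - by exists ((c \o clip) @^-1` A); last by rewrite setTI.
have : ((c \o clip) @^-1` A) (val t) by rewrite B_all.
by rewrite /preimage /= clipK.
Qed.

(** Under an isotopy starting at the identity, each point traces a path that
    cannot leave the clopen set it starts in.  Applied to the complement of the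
    image of [j], this makes the restricted levels surjective. *)
Lemma isotopy_restrict (X Y : topologicalType) (j : Y -> X) (H : X * I -> X) :
  is_embedding j -> clopen (range j) -> continuous H ->
  (forall t, is_homeomorphism (fun x => H (x, t))) ->
  (forall x, H (x, I0 R) = x) ->
  exists h : Y * I -> Y,
    [/\ continuous h, forall y t, j (h (y, t)) = H (j y, t),
        forall y, h (y, I0 R) = y,
        forall t, injective (fun y => h (y, t))
      & forall t y, exists x, h (x, t) = y].
Proof.
move=> jE j_clopen Hc H_homeo H0.
have track_c x : continuous (fun t : I => H (x, t)).
  apply: (continuous_compose _ Hc); apply: continuous_pair => t.
    exact: cst_continuous.
  exact: cvg_id.
have stay p : exists y, j y = H (j p.1, p.2).
  have [|y _ jy] := interval_clopen j_clopen (track_c (j p.1)) _ p.2.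
    by rewrite H0; exists p.1.
  by exists y.
have [h hP] := choice stay; exists h; split.
- apply: (continuous_embedded jE); rewrite (_ : _ \o _ = fun p => H (j p.1, p.2)).
    apply: (continuous_compose _ Hc); apply: continuous_pair.
      apply: continuous_compose; first exact: continuous_fst.
      exact: embedding_continuous.
    exact: continuous_snd.
  by apply/funext => p; exact: hP.
- by move=> y t; rewrite hP.
- by move=> y; apply: (proj1 jE); rewrite hP H0.
- move=> t y y' e; have [_ [g [_ gK _]]] := H_homeo t.
  apply: (proj1 jE); apply: (can_inj gK) => /=.
  by rewrite -(hP (y, t)) -(hP (y', t)) e.
- move=> t y; have [_ [g [_ _ gK]]] := H_homeo t.
  have [[x _ jx]|nj] := pselect (range j (g (j y))).
    by exists x; apply: (proj1 jE); rewrite hP /= jx gK.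
  have []// := interval_clopen (clopenC set0 j_clopen) (track_c (g (j y))) _ t.
    by rewrite H0.
  by exists y => //; rewrite gK.
Qed.

(** For [a] and [b] in the interval nothing is clipped: [clip] then only supplies
    the codomain. *)
Definition affine (a b : R) (t : I) : I := clip (a + (b - a) * val t).

Lemma affineE (a b : R) (t : I) : 0 <= a <= 1 -> 0 <= b <= 1 ->
  val (affine a b t) = a + (b - a) * val t.
Proof. by move=> a01 b01; apply: clipE; have := val_interval t; nra. Qed.

Lemma continuous_affine (a b : R) : continuous (affine a b).
Proof.
have affine_c : continuous (fun r : R => a + (b - a) * r).
  move=> r; apply: cvgD; first exact: cvg_cst.
  by apply: cvgM; [exact: cvg_cst|exact: cvg_id].
apply: (continuous_compose _ continuous_clip).
exact: (continuous_compose continuous_val affine_c).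
Qed.

Definition lower_half := affine 0 2^-1.
Definition upper_half := affine 2^-1 1.
Definition flip := affine 1 0.

Lemma lower_halfE (t : I) : val (lower_half t) = val t / 2.
Proof. by rewrite affineE; lra. Qed.

Lemma upper_halfE (t : I) : val (upper_half t) = (1 + val t) / 2.
Proof. by rewrite affineE; lra. Qed.

Lemma flipE (t : I) : val (flip t) = 1 - val t.
Proof. by rewrite affineE; lra. Qed.

Lemma lower_half_inj : injective lower_half.
Proof.
move=> t s /(congr1 val); rewrite !lower_halfE => e.
by apply: val_inj; lra.
Qed.

Lemma upper_half_inj : injective upper_half.
Proof.
move=> t s /(congr1 val); rewrite !upper_halfE => e.
by apply: val_inj; lra.
Qed.

Lemma lower_half0 : lower_half (I0 R) = I0 R.
Proof. by apply/val_inj; rewrite lower_halfE /= mul0r. Qed.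

Lemma upper_half1 : upper_half (I1 R) = I1 R.
Proof. by apply/val_inj; rewrite upper_halfE /=; lra. Qed.

Lemma flip0 : flip (I0 R) = I1 R.
Proof. by apply/val_inj; rewrite flipE /= subr0. Qed.

Lemma flip1 : flip (I1 R) = I0 R.
Proof. by apply/val_inj; rewrite flipE /= subrr. Qed.

End interval.

(** * Bordisms *)

Section bordisms.
Variables (R : realType) (n : nat).
Implicit Types M N : closed_manifold R n.

Lemma subbordism_id_subproof M N (W : bordism M N) : is_embedding (@id W).
Proof. by apply: (is_embedding_cancel (g := id)) => // x; exact: cvg_id. Qed.

Program Definition subbordism_id M N (W : bordism M N) : subbordism W W :=
  @Subbordism _ _ _ _ _ _ W W (Embedding (subbordism_id_subproof W)) _ _.
Next Obligation. by right=> _ [m' _ <-]; exists m'. Qed.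
Next Obligation. by right=> _ [m' _ <-]; exists m'. Qed.

(** As a homeomorphism of bordisms maps the incoming boundary onto the incoming
    one and the outgoing onto the outgoing one, its inverse is again a subbordism,
    so that fields can be restricted back along it. *)
Lemma bordism_homeomorphism_inverse M N M' N' (W : bordism M N)
    (W' : bordism M' N') (Phi : subbordism W W') :
  bordism_homeomorphism Phi ->
  exists Psi : subbordism W' W, cancel Phi Psi /\ cancel Psi Phi.
Proof.
move=> [/homeomorphism_inverse[Psi [PhiK PsiK]] Phi_in Phi_out].
have Psi_in m : range (bd_in W) (Psi (bd_in W' m)).
  have [_ [m0 _ <-] <-] : (Phi @` range (bd_in W)) (bd_in W' m).
    by rewrite Phi_in; exists m.
  by rewrite PhiK; exists m0.
have Psi_out m : range (bd_out W) (Psi (bd_out W' m)).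
  have [_ [m0 _ <-] <-] : (Phi @` range (bd_out W)) (bd_out W' m).
    by rewrite Phi_out; exists m.
  by rewrite PhiK; exists m0.
unshelve eexists; first apply: (@Subbordism _ _ _ _ _ _ W' W Psi).
- by move=> m; right=> _ [m' _ <-]; exact: Psi_in.
- by move=> m; right=> _ [m' _ <-]; exact: Psi_out.
- by split.
Qed.

End bordisms.

(** * The cylinder *)

Section cylinder.
Variables (R : realType) (n : nat) (M : closed_manifold R n).
Local Notation I := (unit_interval R).
Local Notation cyl := (cylinder M).

Lemma range_bd_cylinder (p : cyl) :
  range (bd cyl) p -> p.2 = I0 R \/ p.2 = I1 R.
Proof. by case=> -[m|m] _ <-; [left|right]. Qed.

Lemma reparam_embedding (k : I -> I) : continuous k -> injective k ->
  is_embedding (fun p : cyl => (p.1, k p.2) : cyl).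
Proof.
move=> kc k_inj; apply: compact_hausdorff_embedding.
- exact: bd_compact.
- exact: (@bd_hausdorff _ _ _ _ cyl).
- apply: continuous_pair; first exact: continuous_fst.
  by apply: continuous_compose => //; exact: continuous_snd.
- by move=> [x t] [y s] /= [-> /k_inj ->].
Qed.

(** The outgoing boundary [M x {1/2}] of the lower half is disjoint from the
    boundary of the cylinder, which is one of the two alternatives allowed by
    the definition of a subbordism; symmetrically for the upper half. *)
Program Definition cylinder_lower : subbordism cyl cyl :=
  @Subbordism _ _ _ _ _ _ cyl cyl
    (Embedding (reparam_embedding (@continuous_affine R 0 2^-1) (@lower_half_inj R))) _ _.
Next Obligation.
by right=> _ [m' _ <-]; exists m' => //; exact: (congr1 (pair m') (esym (lower_half0 R))).
Qed.
Next Obligation.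
left; rewrite -subset0 => p [[m' _ <-]] /range_bd_cylinder /=.
by case=> /(congr1 val); rewrite lower_halfE /=; lra.
Qed.

Program Definition cylinder_upper : subbordism cyl cyl :=
  @Subbordism _ _ _ _ _ _ cyl cyl
    (Embedding (reparam_embedding (@continuous_affine R 2^-1 1) (@upper_half_inj R))) _ _.
Next Obligation.
left; rewrite -subset0 => p [[m' _ <-]] /range_bd_cylinder /=.
by case=> /(congr1 val); rewrite upper_halfE /=; lra.
Qed.
Next Obligation.
by right=> _ [m' _ <-]; exists m' => //; exact: (congr1 (pair m') (esym (upper_half1 R))).
Qed.

Lemma cylinder_gluing : is_gluing cylinder_lower cylinder_upper.
Proof.
split.
- rewrite eqEsubset; split=> // -[x t] _; have t01 := val_interval t.
  have [t2|t2] := leP (val t : R) (1 / 2).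
    left; exists (x, clip (val t * 2)) => //; apply/(congr1 (pair x))/val_inj.
    by rewrite lower_halfE clipE; lra.
  right; exists (x, clip (val t * 2 - 1)) => //; apply/(congr1 (pair x))/val_inj.
  by rewrite upper_halfE clipE; lra.
- move=> [x t] [y s]; have t01 := val_interval t; have s01 := val_interval s.
  split=> [e|[k [[-> ->] [-> ->]]]].
    have xy : x = y := congr1 fst e.
    have : lower_half t = upper_half s := congr1 snd e.
    move/(congr1 val); rewrite lower_halfE upper_halfE => ts.
    have v0 : val (I0 R) = 0 by [].
    have v1 : val (I1 R) = 1 by [].
    have -> : t = I1 R by apply/val_inj; rewrite v1; lra.
    have -> : s = I0 R by apply/val_inj; rewrite v0; lra.
    by exists y; rewrite xy.
  apply/(congr1 (pair k))/val_inj.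
  by rewrite lower_halfE upper_halfE /= addr0.
- by move=> m; exact: (congr1 (pair m) (lower_half0 R)).
- by move=> m; exact: (congr1 (pair m) (upper_half1 R)).
Qed.

(** The isotopy of the incoming copy of [M] is run backwards in the direction of
    the cylinder and that of the outgoing copy forwards, so that at each end the
    other isotopy is at its identity stage.  Composing the two at every level
    avoids pasting along [M x {1/2}]. *)
Lemma cylinder_isotopy (phi : embedding (closed_sum M M) (closed_sum M M)) :
  isotopic_to_id phi ->
  is_homeomorphism phi /\
  exists2 Phi : subbordism cyl cyl,
    bordism_homeomorphism Phi & Phi \o bd cyl =1 bd cyl \o phi.
Proof.
move=> [H [Hc H_homeo H0 H1]]; split.
  by rewrite (_ : emb_fun phi = fun x => H (x, I1 R)) //; apply/funext.
have [a [ac aH a0 a_inj a_surj]] := isotopy_restrict (is_embedding_inl M M)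
  (clopen_range_inl M M) Hc H_homeo H0.
have [b [bc bH b0 b_inj b_surj]] := isotopy_restrict (is_embedding_inr M M)
  (clopen_range_inr M M) Hc H_homeo H0.
pose Phi (p : cyl) : cyl := (b (a (p.1, flip p.2), p.2), p.2).
(* Injectivity and surjectivity hold level by level, since [t] is preserved. *)
have PhiE : is_embedding Phi.
  apply: compact_hausdorff_embedding.
  - exact: bd_compact.
  - exact: (@bd_hausdorff _ _ _ _ cyl).
  - apply: continuous_pair; last exact: continuous_snd.
    apply: (continuous_compose _ bc).
    apply: continuous_pair; last exact: continuous_snd.
    apply: (continuous_compose _ ac).
    apply: continuous_pair; first exact: continuous_fst.
    by apply: continuous_compose (@continuous_affine R 1 0); exact: continuous_snd.
  - by move=> [x t] [y s] /= [+ ts]; subst s => /b_inj /a_inj ->.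
have Phi_homeo : is_homeomorphism Phi.
  apply: surjective_embedding_homeomorphism => // -[y t].
  have [z zy] := b_surj t y; have [x xz] := a_surj (flip t) z.
  by exists (x, t); rewrite /Phi /= xz zy.
have Phi_in m : Phi (bd_in cyl m) = bd_in cyl (a (m, I1 R)).
  by rewrite /Phi /= flip0 b0.
have Phi_out m : Phi (bd_out cyl m) = bd_out cyl (b (m, I1 R)).
  by rewrite /Phi /= flip1 a0.
unshelve eexists.
- apply: (@Subbordism _ _ _ _ _ _ cyl cyl (Embedding PhiE)) => m; right.
    by move=> _ [m' _ <-]; exists (a (m', I1 R)) => //; exact/esym/Phi_in.
  by move=> _ [m' _ <-]; exists (b (m', I1 R)) => //; exact/esym/Phi_out.
- split=> //=.
  + rewrite eqEsubset; split=> [_ [_ [m _ <-] <-]|_ [m _ <-]].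
      by exists (a (m, I1 R)) => //; exact/esym/Phi_in.
    have [m' <-] := a_surj (I1 R) m.
    by exists (bd_in cyl m'); [exists m'|exact: Phi_in].
  + rewrite eqEsubset; split=> [_ [_ [m _ <-] <-]|_ [m _ <-]].
      by exists (b (m, I1 R)) => //; exact/esym/Phi_out.
    have [m' <-] := b_surj (I1 R) m.
    by exists (bd_out cyl m'); [exists m'|exact: Phi_out].
- move=> [m|m] /=; rewrite -H1.
  + by rewrite -aH; exact: Phi_in.
  + by rewrite -bH; exact: Phi_out.
Qed.

End cylinder.

(** * State sums *)

Section state_sums.
Variables (R : realType) (n : nat) (S : completeSemiRingType).
Variables (C : strict_monoidal_category) (F : field_system R n).
Variable (T : action_exponentials C F).
Implicit Types M N P : closed_manifold R n.

Lemma field_pairE M N (f : FM F M) (g : FM F N) :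
  resM (closed_inl M N) (field_pair f g) = f /\
  resM (closed_inr M N) (field_pair f g) = g.
Proof. by rewrite /field_pair; case: cid. Qed.

Lemma FM_sum_inj M N (h h' : FM F (closed_sum M N)) :
  resM (closed_inl M N) h = resM (closed_inl M N) h' ->
  resM (closed_inr M N) h = resM (closed_inr M N) h' -> h = h'.
Proof.
move=> e1 e2; have /bij_inj inj := FM_disj F M N.
by apply: inj; rewrite e1 e2.
Qed.

Lemma of_pairsK M N (z : FM F (closed_sum M N) -> Qmod S C) :
  of_pairs (to_pairs z) = z.
Proof.
apply/funext => h; rewrite /of_pairs /to_pairs; congr z.
have [e1 e2] := field_pairE (resM (closed_inl M N) h) (resM (closed_inr M N) h).
exact: FM_sum_inj.
Qed.

Lemma resWM_bdP M N (W : bordism M N) (G : FW F W) (f : FM F M) (g : FM F N) :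
  resWM (bd W) G = field_pair f g <->
  resWM (bd_in W) G = f /\ resWM (bd_out W) G = g.
Proof.
have [e1 e2] := field_pairE f g.
have inE : resWM (bd_in W) G = resM (closed_inl M N) (resWM (bd W) G).
  exact: resWM_resM.
have outE : resWM (bd_out W) G = resM (closed_inr M N) (resWM (bd W) G).
  exact: resWM_resM.
rewrite inE outE; split=> [->//|[e3 e4]].
by apply: FM_sum_inj; rewrite ?e1 ?e2.
Qed.

(** Both sides are sums over the fields on [W] with the given boundary values,
    the left one grouped by the restriction to the common boundary [N]. *)
Lemma state_sum_glue M N P (W' : bordism M N) (W'' : bordism N P)
    (W : bordism M P) (i' : subbordism W' W) (i'' : subbordism W'' W) :
  is_gluing i' i'' ->
  state_contraction (to_pairs (state_sum S T W')) (to_pairs (state_sum S T W''))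
  = to_pairs (state_sum S T W).
Proof.
move=> glue; apply/funext => f; apply/funext => h.
have midE (G : FW F W) : resWM (bd_out W') (resW i' G) =
    resWM (bd_in W'') (resW i'' G).
  pose k : embedding N W := Embedding (is_embedding_comp (embP i') (embP (bd_out W'))).
  rewrite -(resWM_resW (k := k)) // -(resWM_resW (k := k)) // => x.
  by apply/(glue_meet glue); exists x.
have inE (G : FW F W) : resWM (bd_in W') (resW i' G) = resWM (bd_in W) G.
  by rewrite -(resWM_resW (k := bd_in W)) // => m; exact/esym/(glue_in glue).
have outE (G : FW F W) : resWM (bd_out W'') (resW i'' G) = resWM (bd_out W) G.
  by rewrite -(resWM_resW (k := bd_out W)) // => m; exact/esym/(glue_out glue).
rewrite /state_contraction /to_pairs {3}/state_sum.
rewrite -(csum_partition _ (FM F N) (fun g G =>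
  resWM (bd_out W') (resW i' (sval G)) = g)); last first.
  by move=> G; exists (resWM (bd_out W') (resW i' (sval G))); split.
apply: eq_csum => g; rewrite /state_sum qmul_csum; apply/esym.
(* For fixed [g], gluing matches the fields on [W] that restrict to [g] with
   pairs of a field on [W'] and a field on [W'']. *)
have bd' (G : {G : {G : FW F W | resWM (bd W) G = field_pair f h} |
      resWM (bd_out W') (resW i' (sval G)) = g}) :
    resWM (bd W') (resW i' (sval (sval G))) = field_pair f g.
  case: G => -[G /= /resWM_bdP[Gf Gh]] Gg; apply/resWM_bdP.
  by rewrite inE.
have bd'' (G : {G : {G : FW F W | resWM (bd W) G = field_pair f h} |
      resWM (bd_out W') (resW i' (sval G)) = g}) :
    resWM (bd W'') (resW i'' (sval (sval G))) = field_pair g h.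
  case: G => -[G /= /resWM_bdP[Gf Gh]] Gg; apply/resWM_bdP.
  by rewrite outE -midE.
rewrite -[RHS](csum_reindex (h := fun G => (exist _ _ (bd' G), exist _ _ (bd'' G)))).
  apply: eq_csum => -[[G Gfh] Gg] /=.
  have [dc ->] := TW_glue T glue G.
  by rewrite qmul_qchar.
move=> [[G' eG'] [G'' eG'']].
have /resWM_bdP[G'f G'g] := eG'; have /resWM_bdP[G''g G''h] := eG''.
have [|G [[GG' GG''] G_uniq]] := FW_glue glue (f' := G') (f'' := G'').
  by rewrite G'g.
have Gfh : resWM (bd W) G = field_pair f h.
  by apply/resWM_bdP; rewrite -inE -outE GG' GG''.
have Gg : resWM (bd_out W') (resW i' G) = g by rewrite GG'.
exists (exist _ (exist _ G Gfh) Gg); split.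
  by congr pair; apply: eq_exist.
move=> [[D Dfh] Dg] [DG' DG'']; do 2 apply: eq_exist.
exact: G_uniq.
Qed.

(** Pullback along [Phi] is a bijection between the fields with boundary value
    [f] and those with boundary value [phi^* f], and preserves the action
    exponentials. *)
Lemma state_sum_homeo M N M' N' (W : bordism M N) (W' : bordism M' N')
    (Phi : subbordism W W')
    (phi : embedding (closed_sum M N) (closed_sum M' N'))
    (f : FM F (closed_sum M' N')) :
  bordism_homeomorphism Phi -> is_homeomorphism phi ->
  Phi \o bd W =1 bd W' \o phi ->
  state_sum S T W (resM phi f) = state_sum S T W' f.
Proof.
move=> PhiH /homeomorphism_inverse[psi [phiK psiK]] Phi_bd.
have [Psi [PhiK PsiK]] := bordism_homeomorphism_inverse PhiH.
pose d : embedding (closed_sum M N) W' :=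
  Embedding (is_embedding_comp (embP Phi) (embP (bd W))).
pose e : embedding (closed_sum M' N') W :=
  Embedding (is_embedding_comp (embP Psi) (embP (bd W'))).
have bdPhi (G : {G : FW F W' | resWM (bd W') G = f}) :
    resWM (bd W) (resW Phi (sval G)) = resM phi f.
  case: G => G /= <-.
  by rewrite -(resWM_resW (k := d)) // -(resWM_resM (k := d)).
rewrite /state_sum -(csum_reindex (h := fun G => exist _ _ (bdPhi G))).
  by apply: eq_csum => -[G Gf] /=; rewrite TW_homeo.
have resPhiK (G : FW F W) : resW Phi (resW Psi G) = G.
  rewrite -(resW_comp (k := subbordism_id W)) ?resW_id // => x.
  by rewrite /= PhiK.
have resPsiK (G : FW F W') : resW Psi (resW Phi G) = G.
  rewrite -(resW_comp (k := subbordism_id W')) ?resW_id // => x.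
  by rewrite /= PsiK.
move=> [G Gf].
have bdPsi : resWM (bd W') (resW Psi G) = f.
  rewrite -(resWM_resW (k := e)) // (resWM_resM (i := psi) (j := bd W)); last first.
    move=> x /=; rewrite -[x in LHS]psiK.
    by have /= <- := Phi_bd (psi x); rewrite PhiK.
  rewrite Gf -(resM_comp (k := Embedding (is_embedding_comp (embP phi) (embP psi)))) //.
  by rewrite resM_id // => x; rewrite /= psiK.
exists (exist (fun G => resWM (bd W') G = f) _ bdPsi); split.
  by apply: eq_exist; rewrite /= resPhiK.
move=> [G' G'f] [GG']; apply: eq_exist.
by rewrite -GG' resPsiK.
Qed.

End state_sums.

Theorem proposition9p1 (R : realType) (n : nat) (S : completeSemiRingType)
    (C : strict_monoidal_category) (F : field_system R n)
    (T : action_exponentials C F) (M : closed_manifold R n) :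
  let Z := state_sum S T (cylinder M) in
  state_module Z /\
  of_pairs (state_contraction (to_pairs Z) (to_pairs Z)) = Z.
Proof.
move=> Z; split.
  move=> phi /cylinder_isotopy[phi_homeo [Phi PhiH Phi_bd]] f.
  exact: state_sum_homeo PhiH phi_homeo Phi_bd.
by rewrite (state_sum_glue S T (cylinder_gluing M)) of_pairsK.
Qed.
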